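(* Let $d\ge1$. For any matrix $M\in\mathrm{Mat}(d,\mathbb{Z})$, the associated Artin-Mazur zeta function $\zeta_M(z)=\exp\bigl(\sum_{m=1}^{\infty}\frac{a_m}{m}z^m\bigr)$ has an Euler product representation $$\zeta_M(z)=\prod_{m=1}^{\infty}(1-z^m)^{-c_m}$$ with uniquely determined integers $c_m$ (possibly negative).
   Context: $M$ acts on $\mathbb{T}^d=\mathbb{R}^d/\mathbb{Z}^d$ by $x\mapsto Mx\bmod 1$. For $m\ge1$, $a_m$ is the number of isolated fixed points of $M^m$ on $\mathbb{T}^d$ (points that are isolated in the set of all fixed points of $M^m$). The identity is one of formal power series in $z$. *)

(* Defs.v *)
From HB Require Import structures.
From mathcomp Require Import all_boot all_order all_algebra.
From mathcomp Require Import finmap all_classical all_reals all_analysis.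

Set Implicit Arguments.
Unset Strict Implicit.
Unset Printing Implicit Defensive.

Import Order.TTheory GRing.Theory Num.Theory.
Import numFieldNormedType.Exports.

Local Open Scope classical_set_scope.
Local Open Scope ring_scope.

Record fps (A : Type) := Fps { coefs :> nat -> A }.

Section FpsRing.
Variable A : comNzRingType.
Implicit Types F G H : fps A.

HB.instance Definition _ := gen_eqMixin (fps A).
HB.instance Definition _ := gen_choiceMixin (fps A).

Lemma fpsP F G : (forall n, F n = G n) <-> F = G.
Proof.
by case: F G => [f] [g]; split=> [/= /funext ->|[->]].
Qed.

Definition fps_zero : fps A := Fps (fun=> 0).
Definition fps_opp F : fps A := Fps (fun n => - F n).
Definition fps_add F G : fps A := Fps (fun n => F n + G n).
Definition fps_one : fps A := Fps (fun n => (n == 0%N)%:R).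
Definition fps_mul F G : fps A := Fps (fun n => \sum_(i < n.+1) F i * G (n - i)%N).

#[local] Fact fps_addA : associative fps_add.
Proof. by move=> F G H; apply/fpsP => n /=; rewrite addrA. Qed.
#[local] Fact fps_addC : commutative fps_add.
Proof. by move=> F G; apply/fpsP => n /=; rewrite addrC. Qed.
#[local] Fact fps_add0 : left_id fps_zero fps_add.
Proof. by move=> F; apply/fpsP => n /=; rewrite add0r. Qed.
#[local] Fact fps_addN : left_inverse fps_zero fps_opp fps_add.
Proof. by move=> F; apply/fpsP => n /=; rewrite addNr. Qed.

HB.instance Definition _ :=
  GRing.isZmodule.Build (fps A) fps_addA fps_addC fps_add0 fps_addN.

(* The ring laws are inherited from polynomials by truncation. *)
#[local] Definition trunc n F : {poly A} := \poly_(i < n.+1) F i.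

#[local] Fact coef_trunc n F k : (k <= n)%N -> (trunc n F)`_k = F k.
Proof. by move=> kn; rewrite coef_poly ltnS kn. Qed.

#[local] Fact fps_polymulE n F G (p q : {poly A}) :
    (forall k, (k <= n)%N -> p`_k = F k) -> (forall k, (k <= n)%N -> q`_k = G k) ->
  forall k, (k <= n)%N -> (p * q)`_k = fps_mul F G k.
Proof.
move=> pF qG k kn; rewrite coefM /=; apply: eq_bigr => i _.
by rewrite pF ?qG// (leq_trans _ kn)// ?leq_subr// -ltnS.
Qed.

#[local] Fact fps_mulC : commutative fps_mul.
Proof.
move=> F G; apply/fpsP => n.
have tr := @coef_trunc n.
have <- := fps_polymulE (tr F) (tr G) (leqnn n).
have <- := fps_polymulE (tr G) (tr F) (leqnn n).
by rewrite mulrC.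
Qed.

#[local] Fact fps_mulA : associative fps_mul.
Proof.
move=> F G H; apply/fpsP => n.
have tr := @coef_trunc n.
have <- := fps_polymulE (tr F) (fps_polymulE (tr G) (tr H)) (leqnn n).
have <- := fps_polymulE (fps_polymulE (tr F) (tr G)) (tr H) (leqnn n).
by rewrite mulrA.
Qed.

#[local] Fact fps_mul1 : left_id fps_one fps_mul.
Proof.
move=> F; apply/fpsP => n /=; rewrite big_ord_recl /= mul1r subn0.
by rewrite big1 ?addr0// => i _; rewrite mul0r.
Qed.

#[local] Fact fps_mulDl : left_distributive fps_mul fps_add.
Proof.
move=> F G H; apply/fpsP => n /=; rewrite -big_split/=.
by apply: eq_bigr => i _; rewrite mulrDl.
Qed.

#[local] Fact fps_one_neq0 : fps_one != 0.
Proof.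
by apply/eqP => /fpsP /(_ 0%N) /= /eqP; rewrite oner_eq0.
Qed.

HB.instance Definition _ := GRing.Zmodule_isComNzRing.Build (fps A)
  fps_mulA fps_mulC fps_mul1 fps_mulDl fps_one_neq0.

(* Classical inverse; [fps_unitE] below identifies the units. *)
Definition fps_unit : pred (fps A) := fun F => `[< exists G, G * F = 1 >].
Definition fps_inv F : fps A := xget F [set G | G * F = 1].

#[local] Fact fps_mulV : {in fps_unit, left_inverse 1 fps_inv *%R}.
Proof.
move=> F /asboolP[G GF]; rewrite /fps_inv.
by case: xgetP => [H _ //|/(_ G)/(_ GF)].
Qed.

#[local] Fact fps_unitP F G : G * F = 1 -> fps_unit F.
Proof. by move=> GF; apply/asboolP; exists G. Qed.

#[local] Fact fps_invr_out : {in [predC fps_unit], fps_inv =1 id}.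
Proof.
move=> F; rewrite inE /= => /asboolP nF; rewrite /fps_inv.
by case: xgetP => // H _ HF; case: nF; exists H.
Qed.

HB.instance Definition _ := GRing.ComNzRing_hasMulInverse.Build (fps A)
  fps_mulV fps_unitP fps_invr_out.

Definition fpsX : fps A := Fps (fun n => (n == 1%N)%:R).

End FpsRing.

Lemma fps_unitE (A : comUnitRingType) (F : fps A) :
  (F \is a GRing.unit) = (F 0%N \is a GRing.unit).
Proof.
apply/idP/idP => [/unitrPr[G /fpsP/(_ 0%N)]|F0].
  by rewrite /= big_ord1 => F0G0; apply/unitrPr; exists (G 0%N).
pose next n s := (F 0%N)^-1 * ((n == 0%N)%:R - \sum_(i < n) F i.+1 * s`_i).
pose s := fix s n := if n is n'.+1 then next n' (s n') :: s n' else [::].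
have sE n i : (i < n)%N -> (s n)`_i = (s (n - i)%N)`_0.
  elim: n i => [//|n IHn] [|i] i_n //=.
  by rewrite IHn// subSS.
pose G := Fps (fun n => (s n.+1)`_0).
apply/unitrPr; exists G; apply/fpsP => n.
have -> : (F * G) n = \sum_(i < n.+1) F i * G (n - i)%N by [].
rewrite big_ord_recl subn0.
have -> : G n = next n (s n) by [].
rewrite /next mulVKr//.
rewrite [X in _ + X](eq_bigr (fun i : 'I_n => F i.+1 * (s n)`_i)) ?subrK//.
by move=> i _; rewrite lift0 sE// -(subnSK (ltn_ord i)).
Qed.

(* Meaningful when [F 0 = 0]: then [F ^+ k] has no coefficient below degree [k],
   so the sum is the whole n-th coefficient of the series [\sum_k F ^+ k / k!]. *)
Definition fps_exp (F : fps rat) : fps rat :=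
  Fps (fun n => \sum_(k < n.+1) (F ^+ k) n / k`!%:R).

(* Convergence of the partial products of [\prod_(m >= 1) G m] to [F] in the
   X-adic topology. *)
Definition fps_prod_cvg (A : comNzRingType) (G : nat -> fps A) (F : fps A) : Prop :=
  forall n, \forall N \near \oo, (\prod_(1 <= m < N.+1) G m) n = F n.

Section Torus.
Variables (R : realType) (d : nat).

Definition lattice : {pred 'cV[R]_d} := [pred x | x \is a mxOver Num.int].

#[local] Fact lattice_zmod_closed : zmod_closed lattice.
Proof.
split=> [|x y /mxOverP xZ /mxOverP yZ]; apply/mxOverP => i j; rewrite !mxE//.
by rewrite rpredB.
Qed.

HB.instance Definition _ :=
  GRing.isZmodClosed.Build 'cV[R]_d lattice lattice_zmod_closed.

Definition torus := quotient_topology (Quotient.quot lattice).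
HB.instance Definition _ := Choice.on torus.
HB.instance Definition _ := Topological.on torus.
HB.instance Definition _ := Quotient.on torus.

Definition torus_map (M : 'M[int]_d) (x : torus) : torus :=
  (\pi_torus (map_mx intr M *m repr x))%qT.

Lemma pi_torusP (x y : 'cV[R]_d) :
  (\pi_torus x = \pi_torus y)%qT <-> x - y \in lattice.
Proof.
have piE := Quotient.idealrBE lattice x y.
by split=> [xy|xy]; [rewrite piE; apply/eqP|move: xy; rewrite piE => /eqP].
Qed.

Lemma torus_mapE (M : 'M[int]_d) (x : 'cV[R]_d) :
  torus_map M (\pi_torus x)%qT = (\pi_torus (map_mx intr M *m x))%qT.
Proof.
have /pi_torusP/mxOverP xZ : (\pi_torus (repr (\pi_torus x)) = \pi_torus x)%qT.
  exact: reprK.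
apply/pi_torusP; rewrite -mulmxBr; apply/mxOverP => i j; rewrite mxE.
by apply: rpred_sum => k _; rewrite mxE rpredM ?intr_int ?xZ.
Qed.

Definition isolated_fixpts (M : 'M[int]_d) (m : nat) : set torus :=
  isolated [set x : torus | torus_map (M ^+ m) x = x].

(* [fset_set A] is [fset0] when [A] is infinite. *)
Definition num_isolated_fixpts (M : 'M[int]_d) (m : nat) : nat :=
  #|` fset_set (isolated_fixpts M m)|%fset.

Definition artin_mazur_zeta (M : 'M[int]_d) : fps rat :=
  fps_exp (Fps (fun m =>
    if m == 0%N then 0 else (num_isolated_fixpts M m)%:R / m%:R)).

End Torus.

Arguments isolated_fixpts R {d} M m.
Arguments num_isolated_fixpts R {d} M m.
Arguments artin_mazur_zeta R {d} M.

(* Only the values [c m] for [m >= 1] matter. *)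
Definition euler_product (F : fps rat) (c : nat -> int) : Prop :=
  fps_prod_cvg (fun m => (1 - fpsX rat ^+ m) ^ (- c m)) F.

(* Main.v *)
Require Import Defs.
From mathcomp Require Import all_boot all_order all_algebra.
From mathcomp Require Import zify lra.

Set Implicit Arguments.
Unset Strict Implicit.
Unset Printing Implicit Defensive.

Import Order.TTheory GRing.Theory Num.Theory.

Local Open Scope ring_scope.

(** Why the theorem holds.  Write a_m for the number of isolated fixed points
    of M^m.  A fixed point of M^m can be translated along the kernel of
    M^m - 1 without ceasing to be fixed, so none is isolated when M^m - 1 is
    singular; when it is nonsingular the fixed points form a finite discrete
    group isomorphic to the kernel of M^m - 1 on (Z/D)^d, for any multiple D of
    the determinant, and the Smith normal form shows that its order is
    |det (M^m - 1)|.  Hence a_m = |det (M^m - 1)| in all cases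
    ([isolated_fixpts_count]).

    Let zeta = exp (sum_m a_m z^m / m) and let theta = z d/dz.  Both zeta and
    the partial products of prod_m (1 - z^m)^(- c_m) satisfy an equation
    theta F = P F, and in characteristic 0 such an equation determines F from P
    and P from F, degree by degree.  Comparing the two series P shows that the
    product converges to zeta if and only if
      sum_(k | m) k c_k = a_m     for all m >= 1        ([euler_productP]).
    This system has exactly one rational solution c, which gives uniqueness;
    what remains is that the solution is integral.

    Integrality follows from the Gauss congruences
      a_m = a_(m/p)  mod p^r,     where p^r is the exact power of p in m:
    they imply that m c_m = a_m - sum_(k | m, k < m) k c_k is divisible by each
    p^r, once the c_k with k < m are known to be integers
    ([euler_exponent_sum]).

    To prove the congruence one may replace M by a power and assume m = p^r.
    If M^m - 1 is nonsingular, the points of (Z/D)^d fixed by M^m but not by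
    M^(m/p) fall into orbits of length exactly p^r
    ([iter_prime_power_card]).  If M^m - 1 is singular then a_m = 0, and what
    must be shown is that p^r divides det (M^(m/p) - 1).  The matrix
    C = (1 + p^r) M is congruent to M modulo p^r, so both determinants may be
    computed from C modulo p^r; and C vanishes modulo 1 + p^r, whence
    det (C^m - 1) is congruent to a sign modulo 1 + p^r and is not 0.  The
    congruence for C, already proved, gives the claim for M
    ([fixdet_congr_prime_power]).  Only divisibility enters here, so the signs
    lost in the absolute values are harmless. *)

(** * Points of prime power period *)

Lemma iter_fixed_mul (T : Type) (f : T -> T) x n k :
  iter n f x = x -> iter (k * n) f x = x.
Proof. by move=> fx; elim: k => //= k IH; rewrite mulSn iterD IH. Qed.

Lemma iter_order_fixed (T : finType) (f : T -> T) x n :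
  (0 < n)%N -> iter n f x = x -> iter (order f x) f x = x.
Proof. by case: n => // n _ fx; apply: (orbitPcycle 3 4).1; exists n. Qed.

Lemma order_dvdn (T : finType) (f : T -> T) x n :
  (0 < n)%N -> iter n f x = x -> (order f x %| n)%N.
Proof.
move=> n0 fx; have fo := iter_order_fixed n0 fx.
have := fx; rewrite {1}(divn_eq n (order f x)) addnC iterD iter_fixed_mul // => fm.
have := findex_iter (ltn_pmod n (order_gt0 f x)).
by rewrite fm findex0 /dvdn => <-.
Qed.

(** The points of period dividing p^(r+1) but not p^r have orbits of length
    exactly p^(r+1), because the proper divisors of p^(r+1) divide p^r; hence
    their number is a multiple of p^(r+1).  The map [f] permutes its periodic
    points, so that [fconnect f] is an equivalence relation on them. *)
Lemma iter_prime_power_card (T : finType) (f : T -> T) p r : prime p ->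
  #|[set x | iter (p ^ r.+1) f x == x]| = #|[set x | iter (p ^ r) f x == x]|
    %[mod p ^ r.+1].
Proof.
move=> p_pr; set A := [set x | _]; set B := [set x | _].
have pr0 k : (0 < p ^ k)%N by rewrite expn_gt0 prime_gt0.
have sBA : B \subset A.
  by apply/subsetP => x; rewrite !inE expnS => /eqP fx; rewrite iter_fixed_mul.
have ordS x : x \in A :\: B -> order f x = (p ^ r.+1)%N.
  rewrite !inE => /andP[nfx /eqP fx].
  have /(dvdn_pfactor _ _ p_pr)[k kr ok] := order_dvdn (pr0 _) fx.
  rewrite ok; case: ltngtP kr => // [kr _|-> //]; case/eqP: nfx.
  rewrite -(subnK (kr : (k <= r)%N)) expnD -ok iter_fixed_mul //.
  exact: iter_order_fixed fx.
(* The points of A are periodic, so going further along the orbit of x leads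
   from any of its points back to x. *)
have symS x y : x \in A -> fconnect f x y -> y \in A /\ fconnect f y x.
  rewrite !inE => /eqP fx /iter_findex; move: (findex f x y) => k <-.
  split; first by rewrite -iterD addnC iterD fx.
  have {2}<- : iter (k * p ^ r.+1 - k) f (iter k f x) = x.
    by rewrite -iterD subnK ?leq_pmulr // iter_fixed_mul.
  exact: fconnect_iter.
have symD x y : x \in A :\: B -> fconnect f x y -> y \in A :\: B.
  rewrite !in_setD => /andP[xB xA] xy; have [yA yx] := symS _ _ xA xy.
  rewrite yA andbT; apply: contra xB; move: yx => /iter_findex <-.
  rewrite !inE => /eqP fy; rewrite -iterD addnC iterD fy //.
have eqv : {in A :\: B & &, equivalence_rel (fconnect f)}.
  move=> x y z /setDP[xA _] /setDP[yA _] _; split=> // xy.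
  apply/idP/idP; last exact: connect_trans.
  exact: connect_trans (symS _ _ xA xy).2.
have part := equivalence_partitionP eqv.
have uni : {in equivalence_partition (fconnect f) (A :\: B),
    forall C : {set T}, #|C| = (p ^ r.+1)%N}.
  move=> _ /imsetP[x xD ->]; rewrite -(ordS x xD); apply: eq_card => y.
  by rewrite inE; apply: andb_idl => /symD; apply.
rewrite -(cardsID B A) (card_uniform_partition uni part) (setIidPr sBA).
by rewrite addnC modnMDl.
Qed.

(** * Kernels of integer matrices over Z/D *)

Lemma Zp_natr_eq0 D n : (1 < D)%N -> ((n%:R : 'Z_D) == 0) = (D %| n)%N.
Proof. by move=> D1; rewrite -val_eqE /= val_Zp_nat. Qed.

Lemma Zp_intr_eq0 D (k : int) : (1 < D)%N -> ((k%:~R : 'Z_D) == 0) = (D %| `|k|)%N.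
Proof.
by move=> D1; case: (intP k) => [|n|n]; rewrite ?rmorphN ?oppr_eq0 ?abszN Zp_natr_eq0.
Qed.

Lemma Zp_intr_mul_eq0 D (e : int) (m : nat) : (1 < D)%N ->
  (e%:~R * m%:R == 0 :> 'Z_D) = (D %| `|e| * m)%N.
Proof. by move=> D1; rewrite -[m%:R]/((m : int)%:~R) -intrM Zp_intr_eq0 // abszM. Qed.

(** With D = k e, the solutions of e w = 0 in Z/D are the multiples of k. *)
Lemma card_Zp_torsion D (e : int) : (1 < D)%N -> (`|e| %| D)%N ->
  #|[set w : 'Z_D | e%:~R * w == 0]| = `|e|%N.
Proof.
move=> D1; set n := `|e|%N => /dvdnP[k Dk].
have n0 : (0 < n)%N by case: posnP Dk => // ->; rewrite muln0 => D0; rewrite D0 in D1.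
have k0 : (0 < k)%N by case: posnP Dk => // -> D0; rewrite D0 in D1.
have lt (i : 'I_n) : (i * k < D)%N by rewrite Dk mulnC ltn_pmul2l.
pose f (i : 'I_n) : 'Z_D := (i * k)%:R.
rewrite -[RHS]card_ord -(card_imset (f := f)); last first.
  move=> i j /(congr1 val); rewrite /= !val_Zp_nat // !modn_small // => /eqP.
  by rewrite eqn_pmul2r // => /eqP/val_inj.
apply: eq_card => w; rewrite inE; apply/idP/imsetP => [|[i _ ->]].
  rewrite -[w]natr_Zp Zp_intr_mul_eq0 // {1}Dk [(_ * w)%N]mulnC.
  rewrite -/n dvdn_pmul2r // => /dvdnP[q wq].
  have qn : (q < n)%N.
    by rewrite -(ltn_pmul2r k0) -wq mulnC -Dk -[X in (_ < X)%N](Zp_cast D1).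
  by exists (Ordinal qn) => //; rewrite /f /= -wq natr_Zp.
by rewrite /f Zp_intr_mul_eq0 // {1}Dk mulnCA [(k * n)%N]mulnC dvdn_mull.
Qed.

Definition modker (D d : nat) (N : 'M[int]_d) : {set 'cV['Z_D]_d} :=
  [set v | map_mx intr N *m v == 0].

(** The equations of a diagonal system are independent, so the solutions are
    counted coordinate by coordinate. *)
Lemma card_modker_diag D d (e : 'rV[int]_d) : (1 < D)%N ->
  (forall i, `|e 0%R i| %| D)%N ->
  #|modker D (diag_mx e)| = (\prod_i `|e 0%R i|)%N.
Proof.
move=> D1 eD; pose P i := [set w : 'Z_D | (e 0 i)%:~R * w == 0].
pose F : {ffun 'I_d -> 'Z_D} -> 'cV['Z_D]_d := fun f => \col_i f i.
have Finj : injective F.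
  by move=> f g /matrixP fg; apply/ffunP => i; have := fg i 0; rewrite !mxE.
have -> : modker D (diag_mx e) = F @: family (fun i => mem (P i)).
  apply/setP => v; rewrite inE; apply/eqP/imsetP => [Nv|[f /familyP fP ->]].
    exists [ffun i => v i 0]; last by apply/matrixP => i j; rewrite !mxE ffunE ord1.
    apply/familyP => i; rewrite ffunE inE; move/matrixP/(_ i 0): Nv.
    by rewrite map_diag_mx mul_diag_mx !mxE => ->.
  apply/matrixP => i j; rewrite map_diag_mx mul_diag_mx !mxE.
  by have := fP i; rewrite inE => /eqP.
rewrite card_imset // card_family foldrE big_map big_enum /=.
by apply: eq_bigr => i _; rewrite card_Zp_torsion.
Qed.

(** The Smith normal form reduces the count to a diagonal matrix: the two
    unimodular factors have determinant 1 or -1 and remain invertible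
    modulo D, so they change neither side. *)
Lemma card_modker D d (N : 'M[int]_d) : (1 < D)%N -> (`|\det N| %| D)%N ->
  #|modker D N| = `|\det N|%N.
Proof.
move=> D1; have [L Lu [V Vu [s _ NE]]] := int_Smith_normal_form N.
pose e : 'rV[int]_d := \row_i s`_i.
have DE : \matrix_(i, j) (s`_i *+ (i == j :> nat)) = diag_mx e :> 'M_d.
  by apply/matrixP => i j; rewrite !mxE.
have absu (U : 'M[int]_d) : U \in unitmx -> `|\det U|%N = 1%N.
  by rewrite unitmxE; case/orP => /eqP ->.
rewrite NE DE !det_mulmx det_diag !abszM (absu _ Lu) (absu _ Vu) mul1n muln1.
rewrite (big_morph _ abszM absz1) => eD.
have {}eD i : (`|e 0%R i| %| D)%N.
  by apply: dvdn_trans eD; rewrite (bigD1 i) //= dvdn_mulr.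
rewrite -(card_modker_diag D1) //.
pose V' := map_mx intr V : 'M['Z_D]_d.
have invK (U : 'M[int]_d) : U \in unitmx ->
    (map_mx intr (invmx U) : 'M['Z_D]_d) *m map_mx intr U = 1%:M.
  by move=> Uu; rewrite -map_mxM mulVmx // map_mx1.
rewrite -[RHS](card_preimset (f := mulmx V')); last first.
  move=> v w /(congr1 (mulmx (map_mx intr (invmx V)))).
  by rewrite !mulmxA invK // !mul1mx.
apply: eq_card => v; rewrite !inE !map_mxM -!mulmxA.
apply/eqP/eqP => [|->]; last by rewrite mulmx0.
move/(congr1 (mulmx (map_mx intr (invmx L)))).
by rewrite !mulmxA invK // mul1mx mulmx0.
Qed.

(** * Gauss congruences for |det (M^m - 1)| *)

(** The number of isolated fixed points of M^m on the torus, as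
    [isolated_fixpts_count] shows; it vanishes when M^m - 1 is singular. *)
Definition fixdet d (M : 'M[int]_d) (m : nat) : nat := `|\det (M ^+ m - 1)|%N.

Lemma map_mxX (R S : pzRingType) (f : {rmorphism R -> S}) d (B : 'M[R]_d) k :
  map_mx f (B ^+ k) = map_mx f B ^+ k.
Proof.
elim: k => [|k IHk]; first by rewrite !expr0 map_mx1.
by rewrite !exprS map_mxM IHk.
Qed.

Lemma map_mx_sub1 (R S : pzRingType) (f : {rmorphism R -> S}) d (B : 'M[R]_d) :
  map_mx f (B - 1) = map_mx f B - 1.
Proof. by rewrite map_mxB map_mx1. Qed.

Lemma iter_mulmx (R : pzRingType) d (A : 'M[R]_d) k (v : 'cV_d) :
  iter k (mulmx A) v = A ^+ k *m v.
Proof.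
elim: k => [|k IHk]; first by rewrite expr0 mul1mx.
by rewrite iterS IHk mulmxA exprS.
Qed.

Lemma modker_fixed D d (B : 'M[int]_d) k :
  modker D (B ^+ k - 1) = [set v | iter k (mulmx (map_mx intr B)) v == v].
Proof.
apply/setP => v; rewrite !inE iter_mulmx map_mx_sub1 map_mxX mulmxBl mul1mx.
by rewrite subr_eq0.
Qed.

Lemma fixdet_dvdn d (B : 'M[int]_d) k m : (k %| m)%N ->
  (fixdet B k %| fixdet B m)%N.
Proof.
case/dvdnP => q ->; rewrite /fixdet mulnC exprM (subrX1 (B ^+ k)).
by rewrite det_mulmx abszM dvdn_mulr.
Qed.

(** Both determinants divide D, so they count the points of (Z/D)^d of period
    dividing p^(r+1) and p^r under B, to which the orbit argument applies. *)
Lemma fixdet_congr_nonsingular d (B : 'M[int]_d) p r : prime p ->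
  fixdet B (p ^ r.+1) != 0%N ->
  fixdet B (p ^ r.+1) = fixdet B (p ^ r) %[mod p ^ r.+1].
Proof.
move=> p_pr nz.
(* The factor 2 makes D at least 2, as the notation 'Z_D requires. *)
pose D := (2 * fixdet B (p ^ r.+1))%N.
have D1 : (1 < D)%N by rewrite /D; lia.
have dv : (fixdet B (p ^ r.+1) %| D)%N by rewrite dvdn_mull.
have dv' := dvdn_trans (fixdet_dvdn B (dvdn_exp2l p (leqnSn r))) dv.
rewrite /fixdet -(card_modker D1 dv) -(card_modker D1 dv') !modker_fixed.
exact: iter_prime_power_card.
Qed.

(** Entrywise congruence modulo n determines det (A^k - 1) modulo n, and
    divisibility by n does not see the sign that [fixdet] discards. *)
Lemma fixdet_dvdn_congr n d (A B : 'M[int]_d) k : (1 < n)%N ->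
  map_mx intr A = map_mx intr B :> 'M['Z_n]_d ->
  (n %| fixdet A k)%N = (n %| fixdet B k)%N.
Proof.
move=> n1 AB; rewrite /fixdet -!Zp_intr_eq0 // -!det_map_mx.
by rewrite !map_mx_sub1 !map_mxX AB.
Qed.

(** In the singular case the left side is 0 and it remains to see that
    q = p^(r+1) divides the right side.  Replacing B by C = (1 + q) B changes
    neither determinant modulo q, but makes the first one nonzero, since C
    vanishes modulo 1 + q; then [fixdet_congr_nonsingular] applies to C. *)
Lemma fixdet_congr_prime_power d (B : 'M[int]_d) p r : prime p ->
  fixdet B (p ^ r.+1) = fixdet B (p ^ r) %[mod p ^ r.+1].
Proof.
move=> p_pr; have [Bz|] := eqVneq (fixdet B (p ^ r.+1)) 0%N; last first.
  exact: fixdet_congr_nonsingular.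
set q := (p ^ r.+1)%N.
have q1 : (1 < q)%N by rewrite -(exp1n r.+1) ltn_exp2r ?prime_gt1.
pose C := q.+1%:Z *: B.
have CB : map_mx intr C = map_mx intr B :> 'M['Z_q]_d.
  apply/matrixP => i j; rewrite !mxE intrM -[X in X * _]/(q.+1%:R).
  by rewrite mulrSr pchar_Zp // add0r mul1r.
have C0 : map_mx intr C = 0 :> 'M['Z_(q.+1)]_d.
  apply/matrixP => i j; rewrite !mxE intrM -[X in X * _]/(q.+1%:R).
  by rewrite pchar_Zp ?mul0r // ltnW.
have Cnz : fixdet C q != 0%N.
  apply: contraTneq (q1 : (1 < q)%N) => Cz.
  have := dvdn0 q.+1; rewrite -{1}Cz -Zp_intr_eq0; last by rewrite ltnW.
  rewrite -det_map_mx map_mx_sub1 map_mxX C0 expr0n.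
  rewrite (gtn_eqF (ltnW q1)) sub0r -scaleN1r detZ det1 mulr1.
  by rewrite -signr_odd; case: odd; rewrite ?expr1 ?oppr_eq0 oner_eq0.
have := fixdet_congr_nonsingular p_pr Cnz.
rewrite -/q Bz mod0n => Ccongr; apply/esym/eqP; rewrite -/(q %| _)%N.
rewrite -(fixdet_dvdn_congr _ q1 CB) /dvdn -Ccongr -/(q %| _)%N.
by rewrite (fixdet_dvdn_congr _ q1 CB) Bz dvdn0.
Qed.

(** Writing m = n p^r with p prime to n, this is the prime power case for the
    matrix B^n. *)
Lemma fixdet_gauss d (B : 'M[int]_d) p m : prime p -> (0 < m)%N -> (p %| m)%N ->
  fixdet B m = fixdet B (m %/ p) %[mod p ^ logn p m].
Proof.
move=> p_pr m0 pm; have [r lr] : exists r, logn p m = r.+1.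
  by exists (logn p m).-1; rewrite prednK // logn_gt0 mem_primes p_pr m0.
have /dvdnP[n mE] := pfactor_dvdnn p m; rewrite lr in mE *.
have -> : (m %/ p = n * p ^ r)%N by rewrite {1}mE expnS mulnCA mulKn ?prime_gt0.
by have := fixdet_congr_prime_power (B ^+ n) r p_pr; rewrite /fixdet -!exprM -mE.
Qed.

(** * Integrality of the exponents *)

Lemma divisor_sum_widen (V : nmodType) (f : nat -> V) m N : (0 < m <= N)%N ->
  \sum_(1 <= k < N.+1 | (k %| m)%N) f k = \sum_(1 <= k < m.+1 | (k %| m)%N) f k.
Proof.
case/andP=> m0 mN; rewrite [RHS](big_nat_widen _ _ N.+1) //=.
by apply: eq_bigl => k; rewrite ltnS; case: (boolP (k %| m)%N) => //= /dvdn_leq->.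
Qed.

Lemma divisor_sum_recr (V : nmodType) (f : nat -> V) m : (0 < m)%N ->
  \sum_(1 <= k < m.+1 | (k %| m)%N) f k = \sum_(1 <= k < m | (k %| m)%N) f k + f m.
Proof. by move=> m0; rewrite big_mkcond big_nat_recr //= -big_mkcond dvdnn. Qed.

(** If m = k j and k does not divide m / p, then p does not divide j, so k
    contains the whole p-part of m. *)
Lemma dvdn_not_quotient p k m : prime p -> (0 < m)%N -> (p %| m)%N ->
  (k %| m)%N -> ~~ (k %| m %/ p)%N -> (p ^ logn p m %| k)%N.
Proof.
move=> p_pr m0 /dvdnP[n mE] /dvdnP[j mkj] nk.
move: m0; rewrite mkj muln_gt0 => /andP[j0 k0].
rewrite lognM // (_ : logn p j = 0%N) ?pfactor_dvdnn //.
apply/eqP; rewrite eqn0Ngt logn_gt0 mem_primes p_pr j0 /=.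
apply: contra nk => /dvdnP[i jE]; apply/dvdnP; exists i.
by rewrite mkj jE mulnAC mulnK // prime_gt0.
Qed.

Section Exponents.
Variable a : nat -> nat.

(** The triangular system sum_(k | m) k c_k = a_m solved for c_m, the first
    argument bounding the depth of the recursion.  The quotient is a Euclidean
    division, which is exact only thanks to the Gauss congruences. *)
Fixpoint euler_exponent_rec n m : int :=
  if n is n'.+1 then
    (((a m)%:Z - \sum_(1 <= k < m | (k %| m)%N) k%:Z * euler_exponent_rec n' k) %/ m)%Z
  else 0.
Definition euler_exponent m := euler_exponent_rec m m.

Lemma euler_exponent_recE n n' m : (m <= n)%N -> (m <= n')%N ->
  euler_exponent_rec n m = euler_exponent_rec n' m.
Proof.
elim: n n' m => [|n IHn] [|n'] m.
- by [].
- by rewrite leqn0 => /eqP-> _ /=; rewrite divz0.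
- by move=> _; rewrite leqn0 => /eqP-> /=; rewrite divz0.
move=> mn mn' /=; congr ((_ - _) %/ _)%Z.
rewrite big_nat_cond [RHS]big_nat_cond; apply: eq_bigr => k /andP[/andP[_ km] _].
by rewrite (IHn n') // -ltnS (leq_trans km).
Qed.

Lemma euler_exponentE m : (0 < m)%N -> euler_exponent m =
  (((a m)%:Z - \sum_(1 <= k < m | (k %| m)%N) k%:Z * euler_exponent k) %/ m)%Z.
Proof.
case: m => // m _; rewrite /euler_exponent /=.
congr ((_ - _) %/ _)%Z.
rewrite big_nat_cond [RHS]big_nat_cond; apply: eq_bigr => k /andP[/andP[_ km] _].
by rewrite (@euler_exponent_recE m k).
Qed.

Hypothesis gauss : forall p m, prime p -> (0 < m)%N -> (p %| m)%N ->
  a m = a (m %/ p) %[mod p ^ logn p m].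

(** By induction c_k is a genuine quotient for k < m.  Fix p dividing m and let
    q be the p-part of m.  The terms of sum_(k | m, k < m) k c_k with k
    dividing m / p add up to a_(m/p), which is a_m modulo q; in the others q
    divides k.  So q divides a_m minus the sum, for every p. *)
Lemma euler_exponent_sum m : (0 < m)%N ->
  \sum_(1 <= k < m.+1 | (k %| m)%N) k%:Z * euler_exponent k = (a m)%:Z.
Proof.
elim/ltn_ind: m => m IHm m0; rewrite divisor_sum_recr //.
set X := \sum_(_ <= _ < _ | _) _.
suff dX : (m%:Z %| (a m)%:Z - X)%Z.
  by rewrite [euler_exponent m]euler_exponentE // -/X mulrC divzK // addrC subrK.
rewrite /dvdz /=; apply/dvdn_partP => // p; rewrite mem_primes => /and3P[p_pr _ pm].
rewrite p_part; set q := (p ^ _)%N.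
change (q%:Z %| (a m)%:Z - X)%Z.
have m'0 : (0 < m %/ p)%N by rewrite divn_gt0 ?prime_gt0 // dvdn_leq.
have m'm : (m %/ p < m)%N by rewrite ltn_Pdiv ?prime_gt1.
rewrite /X (bigID (fun k => (k %| m %/ p)%N)) /=.
rewrite [X in _ - (X + _)](_ : _ = (a (m %/ p))%:Z); last first.
  rewrite -IHm // -(@divisor_sum_widen _ _ _ m.-1); last first.
    by rewrite m'0 -ltnS prednK.
  rewrite prednK //; apply: eq_bigl => k; apply: andb_idl => km.
  by apply: dvdn_trans km _; apply: dvdn_div.
rewrite opprD addrA rpredB //.
  by rewrite -eqz_mod_dvd !modz_nat; apply/eqP; congr Posz; apply: gauss.
apply: rpred_sum => k /andP[km nk]; apply: dvdz_mulr.
exact: dvdn_not_quotient km nk.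
Qed.

End Exponents.

Lemma divisor_sum_inj (c c' : nat -> int) n :
  (forall m, (0 < m <= n)%N -> \sum_(1 <= k < m.+1 | (k %| m)%N) k%:Z * c k =
     \sum_(1 <= k < m.+1 | (k %| m)%N) k%:Z * c' k) ->
  forall m, (0 < m <= n)%N -> c m = c' m.
Proof.
move=> cc'; elim/ltn_ind => m IHm /andP[m0 mn].
have := cc' m; rewrite m0 mn !divisor_sum_recr // => /(_ isT).
rewrite (_ : \sum_(1 <= k < m | _) k%:Z * c k =
             \sum_(1 <= k < m | (k %| m)%N) k%:Z * c' k).
  by move/addrI/mulfI; apply; rewrite eqz_nat -lt0n.
rewrite big_nat_cond [RHS]big_nat_cond; apply: eq_bigr => k /andP[/andP[k1 km] _].
by rewrite IHm // k1 (leq_trans (ltnW km)).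
Qed.

(** * Logarithmic derivatives of power series *)

From mathcomp Require Import finmap all_classical all_reals all_analysis.
Import numFieldNormedType.Exports.

Local Open Scope classical_set_scope.
Local Open Scope ring_scope.

Section LogDerivative.
Variable A : comNzRingType.
Implicit Types F G P Q : fps A.

Lemma coefsM F G n : (F * G) n = \sum_(i < n.+1) F i * G (n - i)%N.
Proof. by []. Qed.
Lemma coefsD F G n : (F + G) n = F n + G n. Proof. by []. Qed.
Lemma coefsN F n : (- F) n = - F n. Proof. by []. Qed.
Lemma coefs1 n : (1 : fps A) n = (n == 0%N)%:R. Proof. by []. Qed.

Lemma coefs_sum I (r : seq I) (p : pred I) (F : I -> fps A) n :
  (\sum_(i <- r | p i) F i) n = \sum_(i <- r | p i) F i n.
Proof. exact: (big_morph (fun G : fps A => G n)). Qed.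

Lemma coefs_mulrn F k n : (F *+ k) n = F n *+ k.
Proof. by elim: k => [|k IHk]; rewrite ?mulr0n // !mulrS coefsD IHk. Qed.

Lemma coefs_mulrz F (z : int) n : (F *~ z) n = F n *~ z.
Proof.
case: (intP z) => [|k|k]; first by rewrite !mulr0z.
- by rewrite -!pmulrn coefs_mulrn.
- by rewrite !mulrNz coefsN -!pmulrn coefs_mulrn.
Qed.

Lemma coefsM0 F G : (F * G) 0%N = F 0%N * G 0%N.
Proof. by rewrite coefsM big_ord1. Qed.

(** The derivation z d/dz, which keeps the degree of each term. *)
Definition fps_theta F : fps A := Fps (fun n => F n *+ n).

Lemma fps_thetaM F G : fps_theta (F * G) = fps_theta F * G + F * fps_theta G.
Proof.
apply/fpsP => n; rewrite coefsD /= -big_split -sumrMnl; apply: eq_bigr => i _ /=.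
by rewrite mulrnAl mulrnAr -mulrnDr subnKC // -ltnS.
Qed.

Lemma fps_theta1 : fps_theta 1 = 0.
Proof. by apply/fpsP => -[|n] /=; rewrite ?mulr0n ?mul0rn. Qed.

Lemma fps_thetaXS F k : fps_theta (F ^+ k.+1) = fps_theta F * F ^+ k *+ k.+1.
Proof.
elim: k => [|k IHk]; first by rewrite expr1 expr0 mulr1.
by rewrite exprS fps_thetaM IHk mulrnAr mulrCA -exprS -mulrS.
Qed.

(** P is the logarithmic derivative of F; the equation avoids dividing by F. *)
Definition log_deriv F P := fps_theta F = P * F.

Lemma log_deriv1 : log_deriv 1 0.
Proof. by rewrite /log_deriv fps_theta1 mul0r. Qed.

Lemma log_derivM F G P Q :
  log_deriv F P -> log_deriv G Q -> log_deriv (F * G) (P + Q).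
Proof.
by rewrite /log_deriv fps_thetaM => -> ->; rewrite mulrDl -mulrA [F * (_ * _)]mulrCA.
Qed.

Lemma log_derivV F P : F \is a GRing.unit -> log_deriv F P -> log_deriv F^-1 (- P).
Proof.
move=> Fu FP; apply: (mulrI Fu); apply/eqP; rewrite mulrCA divrr // mulr1.
rewrite -subr_eq0 opprK -[X in _ + X](mulrK Fu) -FP addrC -fps_thetaM divrr //.
by rewrite fps_theta1.
Qed.

Lemma log_derivX F P k : log_deriv F P -> log_deriv (F ^+ k) (P *+ k).
Proof.
move=> FP; elim: k => [|k IHk]; first by rewrite expr0; apply: log_deriv1.
by rewrite exprS mulrS; apply: log_derivM.
Qed.

Lemma log_deriv_exprz F P (z : int) :
  F \is a GRing.unit -> log_deriv F P -> log_deriv (F ^ z) (P *~ z).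
Proof.
move=> Fu FP; case: (intP z) => [|k|k]; first by rewrite expr0z; apply: log_deriv1.
- exact: log_derivX.
- rewrite mulrNz -exprnN; apply: log_derivV; first by rewrite unitrX.
  exact: log_derivX.
Qed.

Lemma log_deriv_prod I (r : seq I) (p : pred I) (F P : I -> fps A) :
  (forall i, p i -> log_deriv (F i) (P i)) ->
  log_deriv (\prod_(i <- r | p i) F i) (\sum_(i <- r | p i) P i).
Proof.
move=> FP; elim/big_rec2: _ => [|i Q G pi GQ]; first exact: log_deriv1.
exact: log_derivM (FP _ pi) GQ.
Qed.

Lemma coefs0_inv F : F \is a GRing.unit -> F 0%N = 1 -> F^-1 0%N = 1.
Proof.
move=> Fu F0; have := congr1 (fun G : fps A => G 0%N) (divrr Fu).
by rewrite coefsM0 F0 mul1r.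
Qed.

Lemma coefs0_expr F k : F 0%N = 1 -> (F ^+ k) 0%N = 1.
Proof.
move=> F0; elim: k => [|k IHk]; first by rewrite expr0.
by rewrite exprS coefsM0 F0 IHk mul1r.
Qed.

Lemma coefs0_exprz F (z : int) :
  F \is a GRing.unit -> F 0%N = 1 -> (F ^ z) 0%N = 1.
Proof.
move=> Fu F0; case: (intP z) => [|k|k]; first by rewrite expr0z.
- exact: coefs0_expr.
- by rewrite -exprnN coefs0_inv ?unitrX //; apply: coefs0_expr.
Qed.

Lemma coefsXM F n : (fpsX A * F) n = if n is n'.+1 then F n' else 0.
Proof.
rewrite coefsM big_ord_recl /= mul0r add0r; case: n => [|n]; first by rewrite big_ord0.
rewrite big_ord_recl /= mul1r subSS subn0 big1 ?addr0 // => i _.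
by rewrite mul0r.
Qed.

Lemma coefsXnM F m n : (fpsX A ^+ m * F) n = if (m <= n)%N then F (n - m)%N else 0.
Proof.
elim: m n => [|m IHm] n; first by rewrite expr0 mul1r subn0.
rewrite exprS -mulrA coefsXM; case: n => // n; by rewrite IHm ltnS subSS.
Qed.

Lemma coefsXn m n : (fpsX A ^+ m) n = (n == m)%:R.
Proof.
rewrite -[_ ^+ m]mulr1 coefsXnM coefs1.
case: leqP => [mn|nm]; last by rewrite (ltn_eqF nm).
by rewrite subn_eq0 eqn_leq mn andbT.
Qed.

(** The expansion of - m z^m / (1 - z^m). *)
Definition geometric_log_deriv m : fps A :=
  Fps (fun n => if (0 < n)%N && (m %| n)%N then - m%:R else 0).

(** Multiplying by 1 - z^m telescopes the geometric series of step m, leaving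
    only its first term - m z^m, which is theta (1 - z^m). *)
Lemma log_deriv_1subXn m : (0 < m)%N ->
  log_deriv (1 - fpsX A ^+ m) (geometric_log_deriv m).
Proof.
move=> m0; apply/fpsP => n; rewrite mulrBr mulr1 coefsD coefsN mulrC coefsXnM /=.
rewrite coefsXn; case: n => [|n]; first by rewrite [(m <= 0)%N]leqNgt m0 mulr0n subrr.
case: (ltngtP n.+1 m) => [nm|mn|nm].
- by rewrite gtnNdvd //= !subrr mul0rn.
- by rewrite subn_gt0 mn dvdn_subl ?(ltnW mn) //= !subrr mul0rn.
- by rewrite nm m0 dvdnn subnn /= subr0 eqn0Ngt m0 sub0r mulNrn.
Qed.

Lemma unit_1subXn m : (0 < m)%N -> 1 - fpsX A ^+ m \is a GRing.unit.
Proof.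
move=> m0; apply/unitrPr; exists (Fps (fun n => (m %| n)%N%:R)); apply/fpsP => n.
rewrite mulrBl mul1r coefsD coefsN coefsXnM coefs1 /=.
case: leqP => [mn|nm].
  rewrite dvdn_subl // subrr.
  by rewrite gtn_eqF // (leq_trans m0).
by rewrite subr0; case: n nm => [|n] nm; rewrite ?dvdn0 // gtnNdvd.
Qed.

Lemma coefs0_1subXn m : (0 < m)%N -> (1 - fpsX A ^+ m) 0%N = 1.
Proof. by move=> m0; rewrite coefsD coefsN coefsXn coefs1 (ltn_eqF m0) subr0. Qed.

Lemma log_deriv_coef F P n : log_deriv F P ->
  F n *+ n = \sum_(i < n.+1) P i * F (n - i)%N.
Proof. by move/fpsP/(_ n). Qed.

End LogDerivative.

Section LogDerivativeDetermines.
Variables F G P Q : fps rat.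
Hypotheses (FP : log_deriv F P) (GQ : log_deriv G Q) (FG0 : F 0%N = G 0%N).

(** In degree i the equation theta F = P F reads
    i F_i = sum_(1 <= j <= i) P_j F_(i - j), which determines F_i from the
    coefficients of lower degree, as i is invertible. *)
Lemma eq_log_deriv n : (forall i, (i <= n)%N -> P i = Q i) -> P 0%N = 0 ->
  forall i, (i <= n)%N -> F i = G i.
Proof.
move=> PQ P0; elim/ltn_ind => -[//|i] IHi iN.
suff : F i.+1 *+ i.+1 = G i.+1 *+ i.+1 
  by rewrite -[LHS]mulr_natr -[RHS]mulr_natr => /mulIf; apply; rewrite pnatr_eq0.
rewrite (log_deriv_coef _ FP) (log_deriv_coef _ GQ) big_ord_recl [RHS]big_ord_recl.
rewrite -[Q ord0]PQ // [P ord0]P0 !mul0r !add0r; apply: eq_bigr => j _.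
rewrite lift0 subSS PQ ?(leq_trans (ltn_ord j)) // 1?ltnW // IHi //.
  by rewrite ltnS leq_subr.
by rewrite (leq_trans (leq_subr _ _)) // ltnW.
Qed.

(** The same recursion read in the other direction: P_i is the only term of
    degree i in P, and it is multiplied by F_0 = 1. *)
Lemma log_deriv_eq n : F 0%N = 1 -> (forall i, (i <= n)%N -> F i = G i) ->
  forall i, (i <= n)%N -> P i = Q i.
Proof.
move=> F0 FG; elim/ltn_ind => i IHi iN.
have := log_deriv_coef i FP; rewrite FG // (log_deriv_coef _ GQ).
rewrite !big_ord_recr /= subnn -FG0 F0 !mulr1 => /esym.
rewrite (eq_bigr (fun j : 'I_i => Q j * G (i - j)%N)); first by move/addrI.
move=> j _; rewrite IHi // ?FG //; last by rewrite ltnW // (leq_trans (ltn_ord j)).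
by rewrite (leq_trans (leq_subr _ _)).
Qed.
End LogDerivativeDetermines.

Lemma coefs_expr_small (A : comNzRingType) (L : fps A) k n :
  L 0%N = 0 -> (n < k)%N -> (L ^+ k) n = 0.
Proof.
move=> L0; elim: k n => // k IHk n nk; rewrite exprS coefsM big1 // => -[i /=].
case: i => [|i] iN _; first by rewrite L0 mul0r.
by rewrite IHk ?mulr0 //; lia.
Qed.

(** theta (L^(k+1) / (k+1)!) = theta L * L^k / k!, summed over k.  Each
    coefficient of [fps_exp] is a sum truncated at its own degree; since L^k has
    no term below degree k, all these truncations may be taken at the same
    bound before exchanging the sums. *)
Lemma log_deriv_exp (L : fps rat) : L 0%N = 0 -> log_deriv (fps_exp L) (fps_theta L).
Proof.
move=> L0; apply/fpsP => n.
have expE N k : (k < N)%N -> fps_exp L k = \sum_(j < N) (L ^+ j) k / j`!%:R.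
  move=> kN /=; rewrite (big_ord_widen _ (fun j => (L ^+ j) k / j`!%:R) kN).
  rewrite big_mkcond /=; apply: eq_bigr => j _; case: ltnP => // kj.
  by rewrite coefs_expr_small ?mul0r.
transitivity (\sum_(k < n) (fps_theta L * L ^+ k) n / k`!%:R).
  have -> : fps_theta (fps_exp L) n = fps_exp L n *+ n by [].
  rewrite (expE n.+1) // -sumrMnl big_ord_recl [X in X + _](_ : _ = 0) ?add0r.
    apply: eq_bigr => k _; rewrite lift0 -mulrnAl.
    rewrite -[X in X / _]/((fps_theta (L ^+ k.+1)) n) fps_thetaXS coefs_mulrn.
    rewrite -[_ *+ k.+1]mulr_natr factS natrM invfM mulrA mulfK ?pnatr_eq0 //.
  rewrite expr0 coefs1.
  by case: n {expE} => [|n]; rewrite ?mulr0n // mul0r mul0rn.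
rewrite [RHS]coefsM [RHS]big_ord_recl [fps_theta L _]mulr0n mul0r add0r.
transitivity (\sum_(i < n) \sum_(k < n)
    fps_theta L i.+1 * ((L ^+ k) (n - i.+1)%N / k`!%:R)).
  rewrite exchange_big; apply: eq_bigr => k _.
  rewrite coefsM big_ord_recl [fps_theta L _]mulr0n mul0r add0r mulr_suml.
  by apply: eq_bigr => i _; rewrite lift0 mulrA.
apply: eq_bigr => i _; rewrite lift0 -mulr_sumr -expE //.
by rewrite ltn_subrL (leq_trans _ (ltn_ord i)).
Qed.

Definition partial_euler_product (c : nat -> int) N : fps rat :=
  \prod_(1 <= m < N.+1) (1 - fpsX rat ^+ m) ^ (- c m).

Lemma coefs0_partial_euler_product c N : partial_euler_product c N 0%N = 1.
Proof.
rewrite /partial_euler_product big_nat.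
apply: (big_ind (fun F : fps rat => F 0%N = 1)) => [//|F G F1 G1|m /andP[m0 _]].
  by rewrite coefsM0 F1 G1 mulr1.
by apply: coefs0_exprz; [exact: unit_1subXn|exact: coefs0_1subXn].
Qed.

(** The factor (1 - z^m)^(- c_m) contributes m c_m to the coefficients in the
    positive degrees divisible by m. *)
Lemma log_deriv_partial_euler_product c N :
  log_deriv (partial_euler_product c N)
    (Fps (fun n => if n == 0%N then 0 else
       (\sum_(1 <= k < N.+1 | (k %| n)%N) k%:Z * c k)%:~R)).
Proof.
rewrite (_ : Fps _ =
    \sum_(1 <= m < N.+1) geometric_log_deriv rat m *~ (- c m)); last first.
  apply/fpsP => n; rewrite coefs_sum /=; case: eqP => [->|/eqP n0].
    by rewrite big1 // => m _; rewrite coefs_mulrz mul0rz.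
  rewrite rmorph_sum /= big_mkcond; apply: eq_bigr => m _.
  rewrite coefs_mulrz /= lt0n n0; case: (m %| n)%N; last by rewrite mul0rz.
  by rewrite mulrNz mulNrz opprK intrM mulrzr.
rewrite /partial_euler_product big_nat [X in log_deriv _ X]big_nat.
apply: log_deriv_prod => m /andP[m0 _].
exact: log_deriv_exprz (unit_1subXn _ m0) (log_deriv_1subXn _ m0).
Qed.

Section EulerProductExponents.
Variables (a : nat -> nat) (c : nat -> int).

Definition exp_zeta : fps rat :=
  fps_exp (Fps (fun m => if m == 0%N then 0 else (a m)%:R / m%:R)).

Lemma coefs0_exp_zeta : exp_zeta 0%N = 1.
Proof. by rewrite /= big_ord1 expr0. Qed.

Lemma log_deriv_exp_zeta :
  log_deriv exp_zeta (Fps (fun n => if n == 0%N then 0 else (a n)%:R)).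
Proof.
rewrite (_ : Fps _ =
  fps_theta (Fps (fun m => if m == 0%N then 0 else (a m)%:R / m%:R))).
  exact: log_deriv_exp.
apply/fpsP => -[|n] //=.
by rewrite -[RHS]mulr_natr divfK // pnatr_eq0.
Qed.

(** In degree i, the logarithmic derivative of the N-th partial product is the
    divisor sum of k c_k over k | i as soon as N >= i, while that of
    [exp_zeta] is a_i.  Agreement of the series up to a degree is equivalent to
    agreement of the logarithmic derivatives up to that degree. *)
Lemma euler_productP : euler_product exp_zeta c <->
  forall m, (0 < m)%N ->
    \sum_(1 <= k < m.+1 | (k %| m)%N) k%:Z * c k = (a m)%:Z.
Proof.
split=> [Fc m m0|ac n]; last first.
  exists n => // N /= nN.
  apply: (eq_log_deriv (log_deriv_partial_euler_product c N) log_deriv_exp_zeta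
    _ (n := n)) => // [|i iN].
    by rewrite coefs0_partial_euler_product coefs0_exp_zeta.
  rewrite /=; case: eqP => // /eqP; rewrite -lt0n => i0.
  by rewrite divisor_sum_widen ?i0 ?(leq_trans iN) // ac.
(* Coefficientwise convergence gives, in degrees up to m, a common index from
   which the partial products agree with the limit. *)
have [N0 FN0] : exists N0, forall N, (N0 <= N)%N ->
    forall i, (i <= m)%N -> partial_euler_product c N i = exp_zeta i.
  elim: m {m0} => [|m [N0 IHm]].
    exists 0%N => N _ i; rewrite leqn0 => /eqP->.
    by rewrite coefs0_partial_euler_product coefs0_exp_zeta.
  have [N1 _ N1F] := Fc m.+1; exists (maxn N0 N1) => N.
  rewrite geq_max => /andP[N0N N1N] i; rewrite leq_eqVlt => /predU1P[->|].
    exact: N1F.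
  exact: IHm.
pose N := maxn N0 m.
have := log_deriv_eq (log_deriv_partial_euler_product c N) log_deriv_exp_zeta
  _ _ (FN0 N (leq_maxl _ _)) (leqnn m).
rewrite coefs0_partial_euler_product coefs0_exp_zeta => /(_ erefl erefl) /=.
rewrite (gtn_eqF m0) divisor_sum_widen ?m0 ?leq_maxr // => /eqP.
by rewrite -[X in _ == X]/((a m)%:Z%:~R) eqr_int => /eqP.
Qed.

End EulerProductExponents.

(** * Isolated fixed points on the torus *)

Lemma int_small (R : archiRealDomainType) (x : R) :
  x \is a Num.int -> `|x| < 1 -> x = 0.
Proof.
case/intrP => k ->; rewrite -intr_norm -[1]/(1%:~R) ltr_int => k1.
by rewrite (_ : k = 0) //; lia.
Qed.

Section Torus.
Variables (R : realType) (d : nat).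
Implicit Types (M N : 'M[int]_d) (x y : 'cV[R]_d).

Local Notation pi := (fun x : 'cV[R]_d => \pi_(torus R d)%qT x).
Local Notation realmx := (map_mx (intr : int -> R)).

Lemma latticeP x : reflect (forall i, x i 0 \is a Num.int) (x \in @lattice R d).
Proof.
apply: (iffP mxOverP) => xZ i => [|j]; first exact: xZ.
by rewrite ord1.
Qed.

Lemma realmx_lattice (u : 'cV[int]_d) : realmx u \in @lattice R d.
Proof. by apply/latticeP => i; rewrite mxE intr_int. Qed.

Lemma lattice_realmx x : x \in @lattice R d -> exists u : 'cV[int]_d, x = realmx u.
Proof.
move=> /latticeP xZ; exists (\col_i Num.floor (x i 0)).
by apply/matrixP => i j; rewrite !mxE ord1 floorK.
Qed.

Lemma lattice_small x : x \in @lattice R d -> (forall i, `|x i 0| < 1) -> x = 0.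
Proof.
move=> /latticeP xZ x1; apply/matrixP => i j; rewrite ord1 mxE.
exact: int_small.
Qed.

Lemma torus_fixedP M x :
  torus_map M (pi x) = pi x <-> realmx (M - 1) *m x \in @lattice R d.
Proof. by rewrite torus_mapE pi_torusP map_mx_sub1 mulmxBl mul1mx. Qed.

Lemma nbhs_torus x (V : set (torus R d)) : nbhs (pi x) V ->
  exists2 e : R, 0 < e & forall y, (forall i, `|x i 0 - y i 0| < e) -> V (pi y).
Proof.
move=> /pi_continuous /nbhs_ballP[e /= e0 eV]; exists e => // y xy.
by apply: eV; split=> // i j; rewrite ord1; apply: xy.
Qed.

(** Let v be a nonzero real vector in the kernel of M^m - 1.  The points x + t v
    are all fixed and tend to x as t tends to 0; for small t > 0 they differ
    from x on the torus because t v is too short to be a lattice vector. *)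
Lemma isolated_singular M m : \det (M ^+ m - 1) = 0 ->
  isolated_fixpts R M m = set0.
Proof.
move=> det0; rewrite -subset0 => q [/set_mem /= fq [V]].
rewrite -[q]reprK in fq *; set x := repr q in fq * => Vx VF.
have [e e0 eV] := nbhs_torus Vx.
have [v v0 Nv] : exists2 v : 'cV[R]_d, v != 0 & realmx (M ^+ m - 1) *m v = 0.
  have : \det (realmx (M ^+ m - 1))^T == 0 by rewrite det_tr det_map_mx det0.
  case/det0P => u u0 uN; exists u^T; first by rewrite trmx_eq0.
  by apply: trmx_inj; rewrite trmx_mul trmxK uN trmx0.
have [i vi0] : exists i, v i 0 != 0.
  by move/matrix0Pn: v0 => [i [j]]; rewrite ord1; exists i.
pose s := \sum_j `|v j 0|.
have vs j : `|v j 0| <= s by rewrite /s (bigD1 j) //= lerDl sumr_ge0.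
have s0 : 0 < s by apply: lt_le_trans (vs i); rewrite normr_gt0.
(* Every entry of t v is bounded both by e, to stay in V, and by 1, so that
   t v is in the lattice only if it is 0. *)
pose t := Num.min e 1 / (2 * s).
have em : 0 < Num.min e 1 by rewrite lt_min e0 ltr01.
have t0 : 0 < t by rewrite divr_gt0 // mulr_gt0.
have tv j : `|t * v j 0| < Num.min e 1.
  rewrite normrM (gtr0_norm t0); apply: (@le_lt_trans _ _ (t * s)).
    by rewrite ler_pM2l.
  rewrite /t invfM mulrA divfK ?gt_eqF //; lra.
have Vy : V (pi (x + t *: v)).
  apply: eV => j; rewrite !mxE opprD addrA subrr sub0r normrN.
  by apply: lt_le_trans (tv j) _; rewrite ge_min lexx.
have Fy : torus_map (M ^+ m) (pi (x + t *: v)) = pi (x + t *: v).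
  apply/torus_fixedP; rewrite mulmxDr -scalemxAr Nv scaler0 addr0.
  exact/torus_fixedP.
have : (V `&` [set y | torus_map (M ^+ m) y = y]) (pi (x + t *: v)) by [].
rewrite VF /= => /pi_torusP; rewrite addrAC subrr add0r => /lattice_small tv0.
have /matrixP/(_ i 0)/eqP : t *: v = 0.
  by apply: tv0 => j; rewrite mxE (lt_le_trans (tv j)) // ge_min lexx orbT.
by rewrite !mxE mulf_eq0 (negPf vi0) gt_eqF.
Qed.

(** If x and x + h are both fixed, (M^m - 1) h is a lattice vector.  When h is
    short it is shorter than 1, hence 0, and h = 0 by invertibility.  The
    neighbourhood is the image of a small cube around x, which is open because
    its preimage is a union of translates of the cube. *)
Lemma isolated_nonsingular M m : \det (M ^+ m - 1) != 0 ->
  isolated_fixpts R M m = [set q | torus_map (M ^+ m) q = q].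
Proof.
move=> det0; apply/seteqP; split=> [q [/set_mem]//|q /= fq].
split; first exact: mem_set.
rewrite -[q]reprK in fq *; set x := repr q in fq *; set N := M ^+ m - 1 in det0.
pose s : R := \sum_i \sum_j `|realmx N i j|.
have s0 : 0 <= s by apply: sumr_ge0 => i _; apply: sumr_ge0.
pose e : R := (1 + s)^-1.
have e0 : 0 < e by rewrite invr_gt0 ltr_wpDr.
exists [set p | exists2 y, pi y = p & forall i, `|y i 0 - x i 0| < e].
  apply: open_nbhs_nbhs; split; last by exists x => // i; rewrite subrr normr0.
  rewrite /open /= /quotient_open openE => y [z /pi_torusP zy zx].
  pose P (i : 'I_d) (j : 'I_1) := ball (x i 0 + (y - z) i 0) e.
  exists P => [i j|w wP].
    apply: open_nbhs_nbhs; split; first exact: ball_open.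
    rewrite /P ord1 /ball /= !mxE distrC; have := zx i.
    by congr (is_true (`|_| < e)); lra.
  exists (w - (y - z)); last first.
    move=> i; have := wP i 0; rewrite /P /ball /= !mxE distrC.
    by congr (is_true (`|_| < e)); lra.
  apply/pi_torusP; rewrite addrAC subrr add0r opprB; exact: zy.
apply/seteqP; split=> [p [[y <-] yx /= /torus_fixedP Ny]|p /= ->]; last first.
  by split=> //; exists x => // i; rewrite subrr normr0.
have Nh : realmx N *m (y - x) \in @lattice R d.
  by rewrite mulmxBr rpredB //; apply/torus_fixedP.
have Nh0 : realmx N *m (y - x) = 0.
  apply: lattice_small => // i; rewrite mxE.
  apply: le_lt_trans (ler_norm_sum _ _ _) _.
  apply: (@le_lt_trans _ _ (s * e)); last first.
    by rewrite /e ltr_pdivrMr ?ltr_wpDr // mul1r ltrDr.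
  rewrite /s [X in _ <= X * _](bigD1 i) //= mulrDl ler_wpDr //.
    by apply: mulr_ge0 (ltW e0); apply: sumr_ge0 => j _; apply: sumr_ge0.
  rewrite mulr_suml; apply: ler_sum => j _; rewrite normrM !mxE.
  by apply: ler_wpM2l => //; apply/ltW/yx.
have : realmx (\adj N) *m (realmx N *m (y - x)) = 0 by rewrite Nh0 mulmx0.
rewrite mulmxA -map_mxM mul_adj_mx map_scalar_mx mul_scalar_mx => /eqP.
rewrite scaler_eq0 intr_eq0 (negPf det0) /= subr_eq0 => /eqP-> //.
Qed.

Section Torsion.
Variables (M : 'M[int]_d) (D : nat).
Hypotheses (D1 : (1 < D)%N) (MD : (`|\det (M - 1)| %| D)%N).

(** The point u / D of the torus, which depends only on u modulo D. *)
Definition torsion_point (u : 'cV[int]_d) : torus R d := pi (D%:R^-1 *: realmx u).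
Let modD (u : 'cV[int]_d) : 'cV['Z_D]_d := map_mx intr u.

Lemma lattice_div u : (D%:R^-1 *: realmx u \in @lattice R d) = (modD u == 0).
Proof.
have D0 : D%:R != 0 :> R by rewrite pnatr_eq0 -lt0n ltnW.
apply/latticeP/eqP => [uZ|/matrixP u0 i].
  apply/matrixP => i j; rewrite !mxE ord1; have := uZ i.
  rewrite !mxE => /intrP[k /(congr1 ( *%R D%:R))]; rewrite mulVKf //.
  rewrite -[D%:R]/((D%:Z)%:~R) -intrM => /intr_inj ->; apply/eqP.
  by rewrite Zp_intr_eq0 // abszM dvdn_mulr.
have := u0 i 0; rewrite !mxE => /eqP; rewrite Zp_intr_eq0 //.
move=> /(@dvdzP D%:Z)[k ->]; rewrite intrM mulrC mulfK //; exact: intr_int.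
Qed.

Lemma torsion_pointP u w : torsion_point u = torsion_point w <-> modD u = modD w.
Proof.
rewrite pi_torusP -scalerBr -map_mxB lattice_div /modD map_mxB subr_eq0.
by split=> /eqP.
Qed.

Lemma torsion_point_fixed u :
  torus_map M (torsion_point u) = torsion_point u <-> modD u \in modker D (M - 1).
Proof. by rewrite torus_fixedP -scalemxAr -map_mxM lattice_div /modD map_mxM inE. Qed.

Definition torsion_lift (v : 'cV['Z_D]_d) : 'cV[int]_d :=
  map_mx (fun z : 'Z_D => (z : nat)%:Z) v.

Lemma torsion_liftK v : modD (torsion_lift v) = v.
Proof. by apply/matrixP => i j; rewrite !mxE; apply: natr_Zp. Qed.

(** If (M - 1) x is an integer vector u, then det (M - 1) x = adj (M - 1) u is
    one too, and so is D x. *)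
Lemma fixed_torsion q : torus_map M q = q -> exists u, q = torsion_point u.
Proof.
have D0 : D%:R != 0 :> R by rewrite pnatr_eq0 -lt0n ltnW.
rewrite -[q]reprK => /torus_fixedP/lattice_realmx[u Nu].
have [k Dk] : exists k : int, D%:Z = k * \det (M - 1).
  by apply/dvdzP; rewrite /dvdz.
exists (k *: (\adj (M - 1) *m u)); rewrite /torsion_point; congr (\pi_(torus R d))%qT.
apply: (scalerI D0); rewrite scalerA divff // scale1r map_mxZ map_mxM -Nu mulmxA.
by rewrite -map_mxM mul_adj_mx map_scalar_mx mul_scalar_mx scalerA -intrM -Dk.
Qed.

Lemma fixed_torsion_image : [set q : torus R d | torus_map M q = q] =
  [set` [fset torsion_point (torsion_lift v) | v in modker D (M - 1)]%fset].
Proof.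
apply/seteqP; split=> [q /= fq|q /=].
  have [u qu] := fixed_torsion fq; apply/imfsetP; exists (modD u).
    by apply/torsion_point_fixed; rewrite -qu.
  by rewrite qu; apply/torsion_pointP; rewrite torsion_liftK.
case/imfsetP => v /= vK ->; apply/torsion_point_fixed.
by rewrite torsion_liftK.
Qed.

Lemma card_fixed_torsion :
  #|` [fset torsion_point (torsion_lift v) | v in modker D (M - 1)]%fset| =
  `|\det (M - 1)|%N.
Proof.
rewrite card_imfset /=; first by rewrite -cardE card_modker.
by move=> v w /torsion_pointP; rewrite !torsion_liftK.
Qed.
End Torsion.

(** When M^m - 1 is nonsingular, u |-> u / D identifies its kernel on (Z/D)^d
    with the fixed points of M^m; the latter are all isolated. *)
Theorem isolated_fixpts_count M m :
  finite_set (isolated_fixpts R M m) /\ num_isolated_fixpts R M m = fixdet M m.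
Proof.
rewrite /num_isolated_fixpts /fixdet.
have [det0|det0] := eqVneq (\det (M ^+ m - 1)) 0.
  by rewrite isolated_singular // fset_set0 det0.
pose D := (2 * `|\det (M ^+ m - 1)|)%N.
have D1 : (1 < D)%N by rewrite /D; lia.
have MD : (`|\det (M ^+ m - 1)| %| D)%N by rewrite dvdn_mull.
rewrite isolated_nonsingular // (fixed_torsion_image D1) // set_fsetK.
by rewrite card_fixed_torsion.
Qed.
End Torus.

(** * The Euler product of the zeta function *)

Theorem proposition2 (R : realType) (d : nat) (M : 'M[int]_d) :
  (0 < d)%N ->
  (forall m : nat, (0 < m)%N -> finite_set (isolated_fixpts R M m)) /\
  exists c : nat -> int,
    euler_product (artin_mazur_zeta R M) c /\
    forall c' : nat -> int, euler_product (artin_mazur_zeta R M) c' ->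
      forall m : nat, (0 < m)%N -> c' m = c m.
Proof.
move=> _; split=> [m _|]; first by have [] := isolated_fixpts_count R M m.
have -> : artin_mazur_zeta R M = exp_zeta (fixdet M).
  rewrite /artin_mazur_zeta /exp_zeta; congr fps_exp; apply/fpsP => m /=.
  by rewrite (isolated_fixpts_count R M m).2.
have sumc := euler_exponent_sum (@fixdet_gauss d M).
exists (euler_exponent (fixdet M)); split; first exact/euler_productP.
move=> c' /euler_productP sumc' m m0; apply: (divisor_sum_inj (n := m)).
  by move=> k /andP[k0 _]; rewrite sumc // sumc'.
by rewrite m0 leqnn.
Qed.
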